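(* Let $$\mathcal{G}_{\mathrm{LA}}(\boldsymbol{\xi},\boldsymbol{\theta})=\nabla_{\boldsymbol{\xi}}\left(-\frac12\log\big(\det(2\pi\boldsymbol{\Sigma}(\boldsymbol{\xi},\boldsymbol{\theta}))\big)-\frac d2-\log(\pi(\boldsymbol{\theta}))\right)$$ be the stochastic gradient estimator, with respect to the design parameter $\boldsymbol{\xi}$, based on the Laplace approximation of the expected information gain, where $\boldsymbol{\Sigma}(\boldsymbol{\xi},\boldsymbol{\theta})$ is the $d\times d$ Laplace-approximation posterior covariance matrix. Then $$\mathcal{G}_{\mathrm{LA}}(\boldsymbol{\xi},\boldsymbol{\theta})=-\frac12\,\boldsymbol{\Sigma}^{-1}(\boldsymbol{\xi},\boldsymbol{\theta})\colon\nabla_{\boldsymbol{\xi}}\boldsymbol{\Sigma}(\boldsymbol{\xi},\boldsymbol{\theta})=-\sum_{k=1}^{d}\sigma_k^{-1}\,\nabla_{\boldsymbol{\xi}}\sigma_k,$$ where $\{\sigma_i^2\}_{i=1}^d$ are the eigenvalues of $\boldsymbol{\Sigma}(\boldsymbol{\xi},\boldsymbol{\theta})$.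
   Context: Setting: $\boldsymbol{\xi}\in\Xi$ is the design parameter vector, $\boldsymbol{\theta}\in\Theta\subset\mathbb{R}^d$ is the parameter with prior density $\pi(\boldsymbol{\theta})$ not depending on $\boldsymbol{\xi}$, $\boldsymbol{g}(\boldsymbol{\xi},\boldsymbol{\theta})\in\mathbb{R}^r$ is the deterministic forward model, $N_e$ is the number of repetitive experiments, and $\boldsymbol{\Sigma}_{\boldsymbol{\epsilon}}$ is the $r\times r$ symmetric positive definite covariance matrix of the Gaussian measurement noise in the data model $\boldsymbol{y}_i=\boldsymbol{g}(\boldsymbol{\xi},\boldsymbol{\theta})+\boldsymbol{\epsilon}_i$. The matrix $\boldsymbol{\Sigma}(\boldsymbol{\xi},\boldsymbol{\theta})$ is the covariance matrix of the Gaussian (Laplace) approximation of the posterior; it is symmetric positive definite, with inverse (to leading order) $$\boldsymbol{\Sigma}^{-1}(\boldsymbol{\xi},\boldsymbol{\theta})=N_e\,\nabla_{\boldsymbol{\theta}}\boldsymbol{g}(\boldsymbol{\xi},\boldsymbol{\theta})\cdot\boldsymbol{\Sigma}_{\boldsymbol{\epsilon}}^{-1}\cdot\nabla_{\boldsymbol{\theta}}\boldsymbol{g}(\boldsymbol{\xi},\boldsymbol{\theta})-\nabla_{\boldsymbol{\theta}}\nabla_{\boldsymbol{\theta}}\log(\pi(\boldsymbol{\theta})),$$ i.e. in components $(\boldsymbol{\Sigma}^{-1})_{lm}=N_e\sum_{i,j}\frac{\partial g_i}{\partial\theta_l}(\boldsymbol{\Sigma}_{\boldsymbol{\epsilon}}^{-1})_{ij}\frac{\partial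 g_j}{\partial\theta_m}-\frac{\partial^2\log\pi}{\partial\theta_l\partial\theta_m}$. Notation: $\colon$ is the double contraction, so that the $s$-th component of $\boldsymbol{\Sigma}^{-1}\colon\nabla_{\boldsymbol{\xi}}\boldsymbol{\Sigma}$ is $\sum_{i,j=1}^d(\boldsymbol{\Sigma}^{-1})_{ij}\,\frac{\partial\Sigma_{ij}}{\partial\xi_s}$. The numbers $\sigma_k>0$ are the positive square roots of the eigenvalues of $\boldsymbol{\Sigma}(\boldsymbol{\xi},\boldsymbol{\theta})$ (counted with multiplicity), viewed as functions of $\boldsymbol{\xi}$. Smoothness convention: all functions are assumed smooth enough for the gradients appearing in the statement to exist; that is, $\boldsymbol{\Sigma}$ is differentiable in $\boldsymbol{\xi}$, and the $\sigma_k$ form a differentiable (in $\boldsymbol{\xi}$) labelling of the square roots of the eigenvalues of $\boldsymbol{\Sigma}$. *)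

(* Defs.v *)
From mathcomp Require Import all_boot all_order all_algebra.
From mathcomp Require Import all_classical all_reals all_analysis.

Set Implicit Arguments.
Unset Strict Implicit.
Unset Printing Implicit Defensive.

Import Order.TTheory GRing.Theory Num.Theory.
Import numFieldNormedType.Exports.

Local Open Scope classical_set_scope.
Local Open Scope ring_scope.

Definition spd (R : realType) (n : nat) (A : 'M[R]_n) : Prop :=
  A^T = A /\ forall v : 'rV[R]_n, v != 0 -> 0 < (v *m A *m v^T) 0 0.

Definition partial (R : realType) (n : nat) (s : 'I_n) (f : 'rV[R]_n -> R)
    (x : 'rV[R]_n) : R :=
  'D_(delta_mx 0 s) f x.

Definition grad (R : realType) (n : nat) (f : 'rV[R]_n -> R) (x : 'rV[R]_n) :
    'rV[R]_n :=
  \row_s partial s f x.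

Definition hessian (R : realType) (n : nat) (f : 'rV[R]_n -> R)
    (x : 'rV[R]_n) : 'M[R]_n :=
  \matrix_(l, m) partial l (partial m f) x.

(* Double contraction of a matrix with the gradient of a matrix field, the
   latter being the d x d array of the gradients of the entries. *)
Definition ddot (R : realType) (d p : nat) (A : 'M[R]_d)
    (T : 'I_d -> 'I_d -> 'rV[R]_p) : 'rV[R]_p :=
  \sum_(i < d) \sum_(j < d) A i j *: T i j.

Definition mxgrad (R : realType) (p d : nat) (S : 'rV[R]_p -> 'M[R]_d)
    (x : 'rV[R]_p) : 'I_d -> 'I_d -> 'rV[R]_p :=
  fun i j => grad (fun x' => S x' i j) x.

(* Integral over R^n with respect to Lebesgue measure, written as an iterated
   integral; for the nonnegative Borel functions it is used on below, this is
   the n-dimensional Lebesgue integral by Tonelli's theorem. *)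
Fixpoint iter_integral (R : realType) (n : nat) :
    ('rV[R]_n -> \bar R) -> \bar R :=
  match n with
  | 0 => fun f => f 0
  | n'.+1 => fun f =>
      (\int[@lebesgue_measure R]_(x in [set: R])
         iter_integral (fun v : 'rV[R]_n' =>
           f (row_mx (x%:M : 'rV[R]_1) v : 'rV[R]_(1 + n'))))%E
  end.

(* Probability density on D with respect to Lebesgue measure; measurability is
   expressed on n-tuples, which carry the product (= Borel) sigma-algebra.
   [f \_ D] is f on D and 0 elsewhere. *)
Definition is_density (R : realType) (n : nat) (D : set 'rV[R]_n)
    (f : 'rV[R]_n -> R) : Prop :=
  [/\ forall x, D x -> 0 <= f x,
      measurable_fun [set: n.-tuple R]
        (fun t : n.-tuple R => (f \_ D) (\row_i tnth t i)) &
      iter_integral (fun x => ((f \_ D) x)%:E) = 1%E].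

(* The library's Jacobian ['J f t] acts on row vectors: its (l, i) entry is
   the derivative of f_i with respect to theta_l. *)
Definition laplace_precision (R : realType) (p d r : nat)
    (g : 'rV[R]_p -> 'rV[R]_d -> 'rV[R]_r) (Seps : 'M[R]_r) (Ne : nat)
    (prior : 'rV[R]_d -> R) (xi : 'rV[R]_p) (theta : 'rV[R]_d) : 'M[R]_d :=
  Ne%:R *: ('J (g xi) theta *m invmx Seps *m ('J (g xi) theta)^T)
  - hessian (fun t => ln (prior t)) theta.

(* [invmx] is the identity on singular matrices, so this matrix is positive
   definite only if the precision matrix is invertible. *)
Definition laplace_cov (R : realType) (p d r : nat)
    (g : 'rV[R]_p -> 'rV[R]_d -> 'rV[R]_r) (Seps : 'M[R]_r) (Ne : nat)
    (prior : 'rV[R]_d -> R) (xi : 'rV[R]_p) (theta : 'rV[R]_d) : 'M[R]_d :=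
  invmx (laplace_precision g Seps Ne prior xi theta).

Definition G_LA (R : realType) (p d r : nat)
    (g : 'rV[R]_p -> 'rV[R]_d -> 'rV[R]_r) (Seps : 'M[R]_r) (Ne : nat)
    (prior : 'rV[R]_d -> R) (xi : 'rV[R]_p) (theta : 'rV[R]_d) : 'rV[R]_p :=
  grad (fun x =>
      - 2^-1 * ln (\det ((2 * pi) *: laplace_cov g Seps Ne prior x theta))
      - d%:R / 2 - ln (prior theta)) xi.

(* The functions sigma_k are positive and their squares are, on A, the
   eigenvalues of the matrix field S, counted with multiplicity. *)
Definition sqrt_eigenvalues (R : realType) (p d : nat) (A : set 'rV[R]_p)
    (S : 'rV[R]_p -> 'M[R]_d) (sigma : 'I_d -> 'rV[R]_p -> R) : Prop :=
  forall x, A x ->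
    (forall k, 0 < sigma k x) /\
    char_poly (S x) = \prod_(k < d) ('X - ((sigma k x) ^+ 2)%:P).

(* Main.v *)
Require Import Defs.
From mathcomp Require Import all_boot all_order all_algebra.
From mathcomp Require Import perm.
From mathcomp Require Import all_classical all_reals all_analysis.

Import Order.TTheory GRing.Theory Num.Theory.
Import numFieldNormedType.Exports.

Local Open Scope classical_set_scope.
Local Open Scope ring_scope.

(** The gradient is taken one coordinate direction at a time, and everything
    comes down to the logarithmic derivative of a determinant,
      D_v (ln (det S)) = tr (S^-1 * D_v S)    where det S > 0,
    which is [is_derive_ln_det]. It follows from Jacobi's formula
      D_v (det S) = tr (adj S * D_v S),
    [is_derive_det], obtained by differentiating the Leibniz expansion of the
    determinant term by term and collecting the permutations s with s i = j
    into the (i, j) cofactor.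

    First equality: apply the formula to (2 pi) *: S. The factor 2 pi cancels
    between the inverse and the derivative, and the remaining terms of the
    Laplace approximation do not depend on xi. The trace is the double
    contraction because S^-1 is symmetric.

    Second equality: evaluating the characteristic polynomial at 0 gives
    det S = \prod_k sigma_k ^ 2 throughout the interior of Xi, hence
    ln (det S) = 2 * \sum_k ln sigma_k near xi. Both sides have the same
    derivative at xi: the left one is tr (S^-1 * D_v S) and the right one is
    2 * \sum_k sigma_k^-1 * D_v sigma_k. *)

(** * Derivatives of logarithms, products and determinants *)

Section DirectionalDerivatives.
Set Implicit Arguments.
Unset Strict Implicit.
Context {R : realType} {V : normedModType R}.
Implicit Types (x v : V).

(** A directional derivative only sees the restriction of [f] to a line, which
    reduces this to the one-variable chain rule; so [f] need only have a
    derivative along [v], not a total differential. *)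
Lemma is_derive_ln_comp (f : V -> R) x v (df : R) :
  0 < f x -> is_derive x v f df ->
  is_derive x v (fun y => ln (f y)) ((f x)^-1 * df).
Proof.
move=> fx_gt0 [f_dv f_val].
pose l (h : R) := f (h *: v + x).
have l0 : l 0 = f x by rewrite /l scale0r add0r.
have onlineE (k : V -> R) : 'D_v k x = 'D_1 (fun h : R => k (h *: v + x)) 0.
  rewrite /derive; set q := fun h => _; set q' := fun h => _.
  suff -> : q = q' by [].
  apply/funext => h; rewrite /q /q' /=.
  by rewrite addr0 scale0r add0r [_%:A]mulr1.
have dl : is_derive (0 : R) 1 l df.
  by apply: DeriveDef; [exact: (derivable1P _ _ _).1 | rewrite -onlineE].
have dln : is_derive (l 0) 1 (@ln R) (f x)^-1.
  by rewrite l0; exact: is_derive1_ln.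
have [lnl_dv lnl_val] := is_derive1_comp dln dl.
by apply: DeriveDef; [exact: (derivable1P _ _ _).2 | rewrite onlineE].
Qed.

Lemma is_derive_big_sum (I : Type) (r : seq I) (F : I -> V -> R) (dF : I -> R)
    x v :
  (forall i, is_derive x v (F i) (dF i)) ->
  is_derive x v (fun y => \sum_(i <- r) F i y) (\sum_(i <- r) dF i).
Proof.
move=> F_dv.
have -> : (fun y => \sum_(i <- r) F i y) = \sum_(i <- r) F i.
  by apply/funext => y; rewrite fct_sumE.
elim/big_ind2 : _ => // [|? ? ? ? ? ?]; first exact: is_derive_cst.
exact: is_deriveD.
Qed.

Lemma is_derive_big_prod n (F : 'I_n -> V -> R) (dF : 'I_n -> R) x v :
  (forall i, is_derive x v (F i) (dF i)) ->
  is_derive x v (fun y => \prod_i F i y)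
    (\sum_i dF i * \prod_(j | i != j) F j x).
Proof.
elim: n F dF => [|n IHn] F dF F_dv.
  rewrite big_ord0 (_ : (fun _ => _) = cst 1); first exact: is_derive_cst.
  by apply/funext => y; rewrite big_ord0.
pose P y := \prod_i F (lift ord0 i) y.
have P_dv : is_derive x v P _ := IHn _ _ (fun i => F_dv (lift ord0 i)).
rewrite (_ : (fun _ => _) = F ord0 * P); last first.
  by apply/funext => y; rewrite big_ord_recl.
apply: is_derive_eq (is_deriveM (F_dv ord0) P_dv) _.
rewrite big_ord_recl addrC /GRing.scale /=; congr (_ + _).
  rewrite mulrC; congr (_ * _).
  by rewrite big_mkcond big_ord_recl /= mul1r; apply: eq_bigr => i _.
rewrite big_distrr; apply: eq_bigr => i _ /=.
rewrite mulrCA; congr (_ * _).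
by rewrite [RHS]big_mkcond big_ord_recl /= [in LHS]big_mkcond /=.
Qed.

(** Jacobi's formula: differentiating the factor of row [i] in every Leibniz
    term, and grouping the permutations by the column [s i] they select, leaves
    the cofactor of that entry multiplied by the derivative of the entry. *)
Lemma is_derive_det n (S : V -> 'M[R]_n) (dS : 'M[R]_n) x v :
  is_derive x v S dS ->
  is_derive x v (fun y => \det (S y)) (\tr (\adj (S x) *m dS)).
Proof.
move=> [S_dv S_val].
have entry_dv i j : is_derive x v (fun y => S y i j) (dS i j).
  apply: DeriveDef; first by move/derivable_mxP : S_dv.
  by rewrite -S_val derive_mx // mxE.
have term_dv (s : 'S_n) : is_derive x v
    (fun y => (-1) ^+ s * \prod_i S y i (s i))
    ((-1) ^+ s * \sum_i dS i (s i) * \prod_(j | i != j) S x j (s j)).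
  exact: is_deriveZ (is_derive_big_prod (fun i => entry_dv i (s i))).
apply: is_derive_eq (is_derive_big_sum _ term_dv) _.
under eq_bigr do rewrite big_distrr.
rewrite mxtrace_mulC exchange_big /=; apply: eq_bigr => i _.
rewrite mxE (partition_big (fun s : 'S_n => s i) predT) //=.
apply: eq_bigr => j _; rewrite mxE expand_cofactor big_distrr /=.
by apply: eq_bigr => s /eqP <-; rewrite mulrCA.
Qed.

Lemma is_derive_ln_det n (S : V -> 'M[R]_n) (dS : 'M[R]_n) x v :
  0 < \det (S x) -> is_derive x v S dS ->
  is_derive x v (fun y => ln (\det (S y))) (\tr (invmx (S x) *m dS)).
Proof.
move=> det_gt0 S_dv.
apply: is_derive_eq (is_derive_ln_comp det_gt0 (is_derive_det S_dv)) _.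
have S_unit : S x \in unitmx by rewrite unitmxE unitfE gt_eqF.
by rewrite /invmx S_unit -scalemxAl mxtraceZ.
Qed.

End DirectionalDerivatives.

(** * Determinant and double contraction *)

(** Evaluation of the characteristic polynomial at 0 gives
    (-1)^n * det A on one side and \prod_i (- a i) on the other. *)
Lemma det_char_poly (F : comNzRingType) n (A : 'M[F]_n) (a : 'I_n -> F) :
  char_poly A = \prod_i ('X - (a i)%:P) -> \det A = \prod_i a i.
Proof.
move=> A_char; have /(congr1 (fun z => (-1) ^+ n * z)) := char_poly_det A.
rewrite A_char mulrA -exprMn mulrNN mulr1 expr1n mul1r => <-.
rewrite -horner_coef0 horner_prod.
under eq_bigr do rewrite hornerXsubC sub0r -mulN1r.
rewrite big_split /= prodr_const card_ord mulrA -exprMn mulrNN mulr1 expr1n.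
by rewrite mul1r.
Qed.

Lemma ln_prod (R : realType) (I : Type) (r : seq I) (f : I -> R) :
  (forall i, 0 < f i) -> ln (\prod_(i <- r) f i) = \sum_(i <- r) ln (f i).
Proof.
move=> f_gt0; elim: r => [|i r IHr]; first by rewrite !big_nil ln1.
by rewrite !big_cons lnM ?posrE ?prodr_gt0 // IHr.
Qed.

(** The contraction pairs entries with equal indices, i.e. it is the trace of
    A^T times the derivative; symmetry of [A] removes the transposition. *)
Lemma ddot_mxgrad_trace (R : realType) (p d : nat) (A : 'M[R]_d)
    (S : 'rV[R]_p -> 'M[R]_d) x s :
  A^T = A -> derivable S x (delta_mx 0 s) ->
  ddot A (mxgrad S x) 0 s = \tr (A *m 'D_(delta_mx 0 s) S x).
Proof.
move=> A_sym S_dv; rewrite -[in RHS]A_sym mxtrace_mulC /mxtrace summxE.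
under [RHS]eq_bigr do rewrite mxE.
apply: eq_bigr => i _; rewrite summxE; apply: eq_bigr => j _.
by rewrite derive_mx // /mxgrad /grad /partial !mxE mulrC.
Qed.

(** * The gradient of the Laplace approximation *)

Theorem proposition2 (R : realType) (p d r : nat)
    (Xi : set 'rV[R]_p) (Theta : set 'rV[R]_d)
    (g : 'rV[R]_p -> 'rV[R]_d -> 'rV[R]_r)
    (Seps : 'M[R]_r) (Ne : nat) (prior : 'rV[R]_d -> R)
    (sigma : 'I_d -> 'rV[R]_p -> R)
    (xi : 'rV[R]_p) (theta : 'rV[R]_d)
    (Ne_gt0 : (0 < Ne)%N)
    (Seps_spd : spd Seps)
    (prior_density : is_density Theta prior)
    (xi_Xi : Xi° xi) (theta_Theta : Theta° theta)
    (prior_gt0 : \forall t \near theta, 0 < prior t)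
    (prior_diff : \forall t \near theta,
       differentiable (fun t' => ln (prior t') : R) t)
    (prior_diff2 : forall m : 'I_d,
       differentiable (partial m (fun t => ln (prior t))) theta)
    (g_diff : forall x, Xi° x -> differentiable (g x) theta)
    (Sigma_spd : forall x, Xi° x ->
       spd (laplace_cov g Seps Ne prior x theta))
    (Sigma_diff :
       differentiable (fun x => laplace_cov g Seps Ne prior x theta) xi)
    (sigma_eig : sqrt_eigenvalues Xi°
       (fun x => laplace_cov g Seps Ne prior x theta) sigma)
    (sigma_diff : forall k : 'I_d, differentiable (sigma k) xi) :
  G_LA g Seps Ne prior xi theta
    = - 2^-1 *: ddot (invmx (laplace_cov g Seps Ne prior xi theta))
        (mxgrad (fun x => laplace_cov g Seps Ne prior x theta) xi)
  /\
  - 2^-1 *: ddot (invmx (laplace_cov g Seps Ne prior xi theta))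
        (mxgrad (fun x => laplace_cov g Seps Ne prior x theta) xi)
    = - \sum_(k < d) (sigma k xi)^-1 *: grad (sigma k) xi.
Proof.
pose S x := laplace_cov g Seps Ne prior x theta.
have near_Xi : \forall x \near xi, Xi° x
  by apply: open_nbhs_nbhs; split => //; exact: open_interior.
have det_S x : Xi° x -> \det (S x) = \prod_k sigma k x ^+ 2.
  by move=> /sigma_eig[_ /det_char_poly].
have det_gt0 : 0 < \det (S xi).
  rewrite det_S //; apply: prodr_gt0 => k _.
  by rewrite exprn_gt0 // (sigma_eig _ xi_Xi).1.
have S_dv s : is_derive xi (delta_mx 0 s) S ('D_(delta_mx 0 s) S xi).
  exact/derivableP/diff_derivable.
have invS_sym : (invmx (S xi))^T = invmx (S xi).
  by rewrite trmx_inv (Sigma_spd _ xi_Xi).1.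
have ddotE s : ddot (invmx (S xi)) (mxgrad S xi) 0 s
    = \tr (invmx (S xi) *m 'D_(delta_mx 0 s) S xi).
  by apply: ddot_mxgrad_trace => //; case: (S_dv s).
have sigma_gt0 k : 0 < sigma k xi by rewrite (sigma_eig _ xi_Xi).1.
split; apply/rowP => s; rewrite [RHS]mxE.
  have twopi_gt0 : 0 < 2 * pi :> R by rewrite mulr_gt0 // pi_gt0.
  have detc_gt0 : 0 < \det (((2 * pi) *: S) xi).
    by rewrite [_ xi]/(_ *: _) detZ mulr_gt0 // exprn_gt0.
  have lndetc_dv := is_derive_ln_det detc_gt0 (is_deriveZ (2 * pi) (S_dv s)).
  rewrite mxE ddotE /partial.
  have cstd_dv := is_derive_cst (d%:R / 2 : R) xi (delta_mx 0 s).
  have cstp_dv := is_derive_cst (ln (prior theta)) xi (delta_mx 0 s).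
  have [_ ->] :=
    is_deriveB (is_deriveB (is_deriveZ (- 2^-1) lndetc_dv) cstd_dv) cstp_dv.
  rewrite !subr0; congr (_ * _).
  have Sc_unit : (2 * pi) *: S xi \in unitmx by rewrite unitmxE unitfE gt_eqF.
  rewrite invmxZ // -scalemxAl -scalemxAr scalerA mulVf ?scale1r //.
  by rewrite gt_eqF.
rewrite mxE ddotE summxE.
have [_ <-] := is_derive_ln_det det_gt0 (S_dv s).
have sigma_dv k :
    is_derive xi (delta_mx 0 s) (sigma k) (partial s (sigma k) xi).
  exact/derivableP/diff_derivable.
have lnsigma_dv : is_derive xi (delta_mx 0 s)
    (2 *: (fun x => \sum_k ln (sigma k x)))
    (2 * \sum_k (sigma k xi)^-1 * partial s (sigma k) xi).
  apply: is_deriveZ; apply: is_derive_big_sum => k.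
  exact: is_derive_ln_comp.
(* Replace ln (det S) by 2 * \sum_k ln sigma_k, equal to it on the interior of
   Xi; that they agree near xi is proved after the derivative is computed. *)
rewrite -(@near_eq_derive _ _ _ (2 *: (fun x => \sum_k ln (sigma k x)))).
  have [_ ->] := lnsigma_dv.
  rewrite mulrA mulNr mulVf ?pnatr_eq0 // mulN1r; congr (- _).
  by apply: eq_bigr => k _; rewrite !mxE.
near=> x.
have Xix : Xi° x by near: x.
have sigmax_gt0 k : 0 < sigma k x by rewrite (sigma_eig _ Xix).1.
rewrite det_S // ln_prod => [|k]; last by rewrite exprn_gt0.
rewrite -[LHS]/(2 * \sum_k ln (sigma k x)) mulr_sumr; apply: eq_bigr => k _.
by rewrite lnXn // mulr_natl.
Unshelve. all: by end_near.
Qed.
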